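(* Let $L$ be a Latin square of order $n$. Then for all $a,b,c,d\in[n]$, $$t_{ab} \equiv t_{cd} \pmod 2.$$
   Context: A Latin square of order $n$ is an $n\times n$ matrix with symbols from $[n]=\{1,\dots,n\}$ in which each symbol appears exactly once in each row and exactly once in each column. For $i,j\in[n]$, $t_{ij}=t_{ij}(L)$ is the number of transversals in the $(n-1)\times(n-1)$ array $L(i\mid j)$ obtained by deleting row $i$ and column $j$ from $L$; here a transversal of an $(n-1)\times(n-1)$ array is a selection of $n-1$ entries (cells), no two of which share their row, column or symbol. *)

(* Defs.v *)
From mathcomp Require Import all_boot all_algebra.

Set Implicit Arguments.
Unset Strict Implicit.
Unset Printing Implicit Defensive.

(* Rows, columns and symbols are all indexed by 'I_n = {0, ..., n-1}. *)
Definition latin_square (n : nat) (L : 'M['I_n]_n) : Prop :=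
  (forall i s : 'I_n, #|[set j : 'I_n | L i j == s]| = 1) /\
  (forall j s : 'I_n, #|[set i : 'I_n | L i j == s]| = 1).

(* A selection of cells is a set of positions (row, column). *)
Definition transversal (S : eqType) (m : nat) (A : 'M[S]_m)
    (T : {set 'I_m * 'I_m}) : bool :=
  (#|T| == m) &&
  [forall x in T, forall y in T,
     (x != y) ==> [&& x.1 != y.1, x.2 != y.2 & A x.1 x.2 != A y.1 y.2]].

Definition num_transversals (S : eqType) (m : nat) (A : 'M[S]_m) : nat :=
  #|[set T : {set 'I_m * 'I_m} | transversal A T]|.

Definition minor_array (S : Type) (n : nat) (L : 'M[S]_n) (i j : 'I_n)
    : 'M[S]_n.-1 :=
  row' i (col' j L).

Definition t (n : nat) (L : 'M['I_n]_n) (i j : 'I_n) : nat :=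
  num_transversals (minor_array L i j).

(* Main.v *)
Require Import Defs.
From mathcomp Require Import all_boot all_algebra.
From mathcomp Require Import perm.

Set Implicit Arguments.
Unset Strict Implicit.
Unset Printing Implicit Defensive.

(** Over the field with two elements a permanent is a determinant, which turns
the parity of a number of transversals into linear algebra.

For a set X of symbols let M_X be the 0/1 matrix marking the cells of L whose
symbol lies in X. Deleting row a and column b from M_X and taking the
determinant counts, modulo 2, the diagonals of the array L(a|b) all of whose
symbols lie in X. Sum this over the sets X of even size: a diagonal with symbol
set U is counted once for each even superset of U. A diagonal of L(a|b) has
n - 1 cells, so U is a proper subset of the n symbols, and it has
2 ^ (n - |U| - 1) even supersets. This number is odd exactly when |U| = n - 1,
that is, when the diagonal is a transversal. Hence t_ab is congruent to the sum
of the (a, b) cofactors of the M_X with |X| even (num_transversals_det,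
t_cofactor).

Since L is Latin, every row and every column of M_X contains exactly |X| ones,
so for |X| even all row and column sums of M_X vanish modulo 2. All cofactors
of such a matrix are equal (cofactor_eq), so the sum above does not depend on
(a, b). *)

Import GRing.Theory.
Local Open Scope ring_scope.

Definition rainbow_perms (S : eqType) (m : nat) (A : 'M[S]_m) : {set 'S_m} :=
  [set s : 'S_m | injectiveb (fun i => A i (s i))].

Definition perm_cells (m : nat) (s : 'S_m) : {set 'I_m * 'I_m} :=
  [set (i, s i) | i : 'I_m].

Lemma perm_cells_inj (m : nat) : injective (@perm_cells m).
Proof.
move=> s s' eq_cells; apply/permP => i.
have : (i, s i) \in perm_cells s' by rewrite -eq_cells imset_f.
by case/imsetP => j _ [-> ->].
Qed.

(** A transversal uses m distinct rows out of m, so it is the graph of a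
function from rows to columns, and distinct columns make it a permutation. *)
Lemma transversal_perm_cells (S : eqType) (m : nat) (A : 'M[S]_m)
    (T : {set 'I_m * 'I_m}) :
  Defs.transversal A T = (T \in (@perm_cells m) @: rainbow_perms A).
Proof.
apply/idP/imsetP => [/andP[/eqP cardT /forall_inP distT]|[s]].
  have dist x y : x \in T -> y \in T -> x != y ->
      [&& x.1 != y.1, x.2 != y.2 & A x.1 x.2 != A y.1 y.2].
    by move=> Tx Ty; move/forall_inP: (distT _ Tx) => /(_ _ Ty)/implyP; apply.
  have inj1 : {in T &, injective fst}.
    move=> x y Tx Ty eq1; apply/eqP; apply: contraT => /(dist _ _ Tx Ty).
    by rewrite eq1 eqxx.
  (* As many cells as rows, in distinct rows: every row is met. *)
  have rowsT : fst @: T = setT.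
    by apply/eqP; rewrite eqEcard subsetT card_in_imset // cardT cardsT card_ord /=.
  have cellP i : {x | x \in T & x.1 == i}.
    apply/sig2W.
    have: i \in fst @: T by rewrite rowsT inE.
    by case/imsetP => x Tx ->; exists x.
  pose f i := (s2val (cellP i)).2.
  have Tf i : (i, f i) \in T.
    by rewrite /f; case: (cellP i) => -[k l] /= Tx /eqP <-.
  have dist_f i j : i != j -> (f i != f j) && (A i (f i) != A j (f j)).
    move=> ij; have := dist _ _ (Tf i) (Tf j).
    by rewrite xpair_eqE negb_and ij => /(_ isT)/andP[].
  have f_inj : injective f.
    by move=> i j eqf; apply/eqP; apply: contraT => /dist_f; rewrite eqf eqxx.
  exists (perm f_inj).
    rewrite inE; apply/injectiveP => i j; rewrite /= !permE => eqA.
    by apply/eqP; apply: contraT => /dist_f; rewrite eqA eqxx andbF.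
  apply/esym/eqP; rewrite eqEcard cardT card_imset; last by move=> i j [].
  rewrite card_ord leqnn andbT.
  by apply/subsetP => _ /imsetP[i _ ->]; rewrite permE.
rewrite inE => /injectiveP s_inj ->; apply/andP; split.
  by rewrite card_imset ?card_ord // => i j [].
apply/forall_inP => _ /imsetP[i _ ->]; apply/forall_inP => _ /imsetP[j _ ->].
rewrite xpair_eqE (inj_eq perm_inj) andbb /=; apply/implyP => ij.
by rewrite ij /=; apply: contra_neq ij; apply: s_inj.
Qed.

Lemma num_transversals_perm (S : eqType) (m : nat) (A : 'M[S]_m) :
  num_transversals A = #|rainbow_perms A|.
Proof.
rewrite -(card_imset _ (@perm_cells_inj m)) /num_transversals.
by apply: eq_card => T; rewrite inE transversal_perm_cells.
Qed.

Lemma F2_natr (k : nat) : k%:R = (odd k)%:R :> 'F_2.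
Proof. by apply: val_inj; rewrite /= !val_Fp_nat // !modn2 oddb. Qed.

Lemma F2_natr_eq_mod (k l : nat) : k%:R = l%:R :> 'F_2 -> k = l %[mod 2].
Proof. by rewrite F2_natr [RHS]F2_natr !modn2; do 2!case: odd. Qed.

Lemma F2_addrr (x : 'F_2) : x + x = 0.
Proof. by rewrite -mulr2n -mulr_natr F2_natr mulr0. Qed.

Lemma F2_signr (k : nat) : (-1) ^+ k = 1 :> 'F_2.
Proof.
have -> : -1 = 1 :> 'F_2 by apply/eqP; rewrite eq_sym -addr_eq0 F2_addrr.
exact: expr1n.
Qed.

Definition indicator_mx (S : finType) (m n : nat) (A : 'M[S]_(m, n))
    (X : {set S}) : 'M['F_2]_(m, n) :=
  \matrix_(i, j) (A i j \in X)%:R.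

(** The signs in the Leibniz formula disappear modulo 2, and the product along
a diagonal is 1 exactly when all its symbols lie in X. *)
Lemma det_indicator_mx (S : finType) (m : nat) (A : 'M[S]_m) (X : {set S}) :
  \det (indicator_mx A X) =
  \sum_(s : 'S_m) ([set A i (s i) | i : 'I_m] \subset X)%:R.
Proof.
apply: eq_bigr => s _; rewrite F2_signr mul1r.
have [/subsetP sub|/subsetPn[_ /imsetP[i _ ->] notX]] := boolP (_ \subset X).
  by rewrite big1 // => i _; rewrite mxE sub //; apply/imsetP; exists i.
by rewrite (bigD1 i) //= mxE (negPf notX) mul0r.
Qed.

(** If two elements x, y lie outside U, toggling both of them preserves parity
and pairs off the even supersets containing x with those that do not. If only
one element lies outside U, the supersets are U and the whole set, and exactly
one of the two has even size. *)
Lemma sum_even_supersets (S : finType) (U : {set S}) :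
  (#|U| < #|S|)%N ->
  \sum_(X : {set S} | ~~ odd #|X|) (U \subset X)%:R
    = (#|U|.+1 == #|S|)%:R :> 'F_2.
Proof.
rewrite -cardsT => ltU.
have [x notUx] : exists x, x \notin U.
  have /subsetPn[x _ ?] : ~~ ([set: S] \subset U).
    by apply: contraTN ltU => /subset_leq_card; rewrite -leqNgt.
  by exists x.
have [cardU|cardU] := eqVneq.
  have topE : [set: S] = x |: U.
    by apply/esym/eqP; rewrite eqEcard subsetT cardsU1 notUx add1n cardU leqnn.
  pose Y := if odd #|U| then [set: S] else U.
  have evenY : ~~ odd #|Y|.
    by rewrite /Y; case: ifP => [oU|->] //; rewrite -cardU /= oU.
  rewrite (bigD1 Y) //= big1 ?addr0 => [|X /andP[evenX neqX]].
    by rewrite /Y; case: ifP; rewrite ?subsetT ?subxx.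
  case: (boolP (U \subset X)) => // subUX; case/eqP: neqX.
  have [Xx|notXx] := boolP (x \in X).
    have XT : X = setT.
      by apply/eqP; rewrite eqEsubset subsetT topE subUset sub1set Xx.
    by move: evenX; rewrite /Y XT -cardU /= negbK => ->.
  have XU : X = U.
    apply/eqP; rewrite eqEsubset subUX andbT; apply/subsetP => y Xy.
    have : y \in x |: U by rewrite -topE inE.
    by case/setU1P => // yx; rewrite yx (negPf notXx) in Xy.
  by move: evenX; rewrite /Y XU => /negPf ->.
have [y yx notUy] : exists2 y, y != x & y \notin U.
  have /subsetPn[y _] : ~~ ([set: S] \subset x |: U).
    apply/negP => /subset_leq_card; rewrite cardsU1 notUx add1n => leS.
    by case/eqP: cardU; apply/eqP; rewrite eqn_leq leS ltU.
  by rewrite !inE negb_or => /andP[]; exists y.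
pose flip z (X : {set S}) := if z \in X then X :\ z else z |: X.
have flipK z : involutive (flip z).
  move=> X; rewrite /flip; have [zX|zX] := boolP (z \in X); first by rewrite setD11 setD1K.
  by rewrite setU11 setU1K.
have flip_odd z X : odd #|flip z X| = ~~ odd #|X|.
  rewrite /flip; case: ifP => zX; last by rewrite cardsU1 zX.
  by rewrite [in RHS](cardsD1 z) zX /= negbK.
have flip_sub z X : z \notin U -> (U \subset flip z X) = (U \subset X).
  move=> notUz; rewrite /flip; case: ifP => zX; first by rewrite subsetD1 notUz andbT.
  apply/idP/idP => [/subsetP sub|sub]; last exact: subset_trans sub (subsetUr _ _).
  apply/subsetP => u Uu; have /setU1P[uz|//] := sub u Uu.
  by rewrite uz (negPf notUz) in Uu.
have flip_x X : (x \in flip y (flip x X)) = (x \notin X).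
  have flipxy Z : (x \in flip y Z) = (x \in Z).
    by rewrite /flip; case: ifP => _; rewrite !inE eq_sym (negPf yx).
  by rewrite flipxy /flip; case: ifP => xX; rewrite !inE eqxx.
have flipsK : bijective (flip y \o flip x).
  by exists (flip x \o flip y) => X /=; rewrite !flipK.
rewrite (bigID (fun X : {set S} => x \in X)) /=.
rewrite (reindex (flip y \o flip x)) /=; last exact: onW_bij.
rewrite (eq_bigl (fun X : {set S} => ~~ odd #|X| && (x \notin X))); last first.
  by move=> X /=; rewrite !flip_odd negbK flip_x.
by under eq_bigr do rewrite !flip_sub //; rewrite F2_addrr.
Qed.

(** Having one symbol more than rows is what makes the even subsets isolate
transversals: the symbol set of a diagonal is then always proper, and it misses
exactly one symbol precisely when the diagonal has no repetition. *)
Lemma num_transversals_det (S : finType) (m : nat) (A : 'M[S]_m) :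
  #|S| = m.+1 ->
  (num_transversals A)%:R =
    \sum_(X : {set S} | ~~ odd #|X|) \det (indicator_mx A X) :> 'F_2.
Proof.
move=> cardS; under [RHS]eq_bigr do rewrite det_indicator_mx.
rewrite exchange_big num_transversals_perm -sum1_card natr_sum big_mkcond /=.
apply: eq_bigr => s _.
have leU : (#|[set A i (s i) | i : 'I_m]| <= m)%N.
  by rewrite -[leqRHS]card_ord leq_imset_card.
rewrite sum_even_supersets cardS ?ltnS // eqSS inE.
suff -> : (#|[set A i (s i) | i : 'I_m]| == m) = injectiveb (fun i => A i (s i)).
  by case: injectiveb.
rewrite -[X in _ == X]card_ord.
apply/imset_injP/injectiveP => [inj i j|inj i j _ _]; last exact: inj.
exact: inj.
Qed.

(** Replacing column b of B by the difference e_a - e_c of two unit vectors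
keeps the column sums zero, so the new determinant is zero; expanding it along
column b gives the difference of the two cofactors. *)
Lemma cofactor_eq_rows (F : fieldType) (n : nat) (B : 'M[F]_n) (a c b : 'I_n) :
  (forall j, \sum_i B i j = 0) -> cofactor B a b = cofactor B c b.
Proof.
move=> col_sum.
pose B' := \matrix_(i, j) (if j == b then (i == a)%:R - (i == c)%:R else B i j).
have cofE i : cofactor B' i b = cofactor B i b.
  rewrite /cofactor; congr (_ * \det _); apply/matrixP => k l.
  by rewrite !mxE eq_sym (negPf (neq_lift _ _)).
have sum_delta (g : 'I_n -> F) k : \sum_i (i == k)%:R * g i = g k.
  rewrite (bigD1 k) //= eqxx mul1r big1 ?addr0 // => i /negPf ->.
  by rewrite mul0r.
have detE : \det B' = cofactor B a b - cofactor B c b.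
  rewrite (expand_det_col B' b).
  under eq_bigr do rewrite mxE eqxx cofE mulrBl.
  by rewrite sumrB !sum_delta.
have det0 : \det B' = 0.
  (* Vanishing column sums say that the all-ones row vector is in the kernel. *)
  apply/eqP/det0P; exists (const_mx 1).
    by apply/eqP => /matrixP/(_ ord0 a)/eqP; rewrite !mxE oner_eq0.
  apply/matrixP => i j; rewrite !mxE.
  under eq_bigr do rewrite !mxE mul1r.
  case: eqP => // _; have := sum_delta (fun=> 1).
  under eq_bigr do rewrite -[X in X - _]mulr1 -[X in _ - X]mulr1.
  by move=> sum1; rewrite sumrB !sum1 subrr.
by apply/eqP; rewrite -subr_eq0 -detE det0.
Qed.

Lemma cofactor_eq (F : fieldType) (n : nat) (B : 'M[F]_n) (a b c d : 'I_n) :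
  (forall i, \sum_j B i j = 0) -> (forall j, \sum_i B i j = 0) ->
  cofactor B a b = cofactor B c d.
Proof.
move=> row_sum col_sum; rewrite (@cofactor_eq_rows _ _ _ a c) //.
rewrite -[LHS]cofactor_tr -[RHS]cofactor_tr; apply: cofactor_eq_rows => j.
by under eq_bigr do rewrite mxE.
Qed.

Lemma sum_indicator_fibres (I S : finType) (f : I -> S) (X : {set S}) :
  (forall s, #|[set i | f i == s]| = 1%N) ->
  \sum_i (f i \in X)%:R = #|X|%:R :> 'F_2.
Proof.
move=> fib1; rewrite -natr_sum -sum1_card; congr _%:R.
rewrite -big_mkcond (partition_big f (mem X)) //=.
apply: eq_bigr => s Xs; rewrite -[RHS](fib1 s) -sum1_card.
by apply: eq_bigl => i; rewrite inE andb_idl // => /eqP ->.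
Qed.

Lemma t_cofactor (n : nat) (L : 'M['I_n]_n) (a b : 'I_n) :
  (t L a b)%:R =
    \sum_(X : {set 'I_n} | ~~ odd #|X|) cofactor (indicator_mx L X) a b :> 'F_2.
Proof.
rewrite /t num_transversals_det; last by rewrite card_ord prednK // (leq_trans _ (ltn_ord a)).
apply: eq_bigr => X _; rewrite /cofactor F2_signr mul1r.
by congr (\det _); apply/matrixP => i j; rewrite !mxE.
Qed.

Local Close Scope ring_scope.

Theorem corollary24 (n : nat) (L : 'M['I_n]_n) (hL : latin_square L)
  (a b c d : 'I_n) :
  t L a b = t L c d %[mod 2].
Proof.
case: hL => row_latin col_latin.
apply: F2_natr_eq_mod; rewrite !t_cofactor.
apply: eq_bigr => X /negPf evenX; apply: cofactor_eq => [i|j].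
  under eq_bigr do rewrite mxE.
  by rewrite (sum_indicator_fibres X (row_latin i)) F2_natr evenX.
under eq_bigr do rewrite mxE.
by rewrite (sum_indicator_fibres X (col_latin j)) F2_natr evenX.
Qed.
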